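(* Let $A, Q : \Pi \rightarrow \mathbb{R}^{n \times n}$ be measurable functions with $A(p)$ stable and $Q(p)$ symmetric as well as positive definite for almost all $p \in \Pi$. The Lyapunov equation $$A(p)^\top M(p) + M(p) A(p) + Q(p) = 0$$ yields a unique solution $M(p) \in \mathbb{R}^{n\times n}$ for almost all $p$. A symmetric decomposition $M(p) = L(p) L(p)^\top$ with $L(p) \in \mathbb{R}^{n \times n}$ is considered for almost all $p$. Furthermore, let $A \in \mathscr{L}^{q_1}(\Pi,\rho)^{n \times n}$, $L \in \mathscr{L}^{q_2}(\Pi,\rho)^{n \times n}$, $L^{-1} \in \mathscr{L}^{q_3}(\Pi,\rho)^{n \times n}$ with $q_k \in [1,\infty]$ for $k=1,2,3$ and $$\tfrac{1}{2} = \tfrac{1}{q_1} + \tfrac{1}{q_2} + \tfrac{1}{q_3} .$$ Using $T(p) := L(p)^\top$, the Galerkin projection of the transformed system $$\dot{y}(t,p) = B(p)\, y(t,p) \qquad \text{with} \qquad B(p) = T(p) A(p) T(p)^{-1}$$ produces an asymptotically stable linear dynamical system.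
   Context: Setting: $n, m, q$ are positive integers. The parameters $p$ are independent random variables with values in $\Pi \subseteq \mathbb{R}^q$ and joint probability density function $\rho : \Pi \rightarrow \mathbb{R}$, where $\Pi = \mathrm{supp}(\rho)$. ''Almost all $p$'' is meant with respect to the probability measure $\rho(p)\,\mathrm{d}p$ on $\Pi$. For measurable $f : \Pi \to \mathbb{R}$, the expected value is $\mathbb{E}[f] := \int_\Pi f(p)\rho(p)\,\mathrm{d}p$, provided that the integral exists; for matrix-valued functions it is applied componentwise. $\mathscr{L}^{r}(\Pi,\rho)$, $r \in [1,\infty]$, is the usual Lebesgue space of measurable real functions on $\Pi$ with respect to the measure $\rho(p)\,\mathrm{d}p$, and $\mathscr{L}^{r}(\Pi,\rho)^{n \times n}$ denotes the matrix-valued functions all of whose entries lie in $\mathscr{L}^{r}(\Pi,\rho)$. If an exponent $q_k$ equals $\infty$, then $\frac{1}{q_k} = 0$. The space $\mathscr{L}^2(\Pi,\rho)$ carries the inner product $\langle f,g\rangle = \int_\Pi f(p)g(p)\rho(p)\,\mathrm{d}p$. $(\Phi_i)_{i \in \mathbb{N}}$ is a given complete orthonormal system in $\mathscr{L}^2(\Pi,\rho)$, and $\Phi_1,\ldots,\Phi_m$ are its first $m$ elements. The (stochastic) Galerkin projection of a linear system $\dot{y}(t,p) = B(p) y(t,p)$ with $B : \Pi \to \mathbb{R}^{n \times n}$ onto $\{\Phi_1,\ldots,\Phi_m\}$ is the linear dynamical system $\dot{\hat{v}}(t) = \hat{B} \hat{v}(t)$, where $\hat{B} \in \mathbb{R}^{mn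 \times mn}$ consists of the $n \times n$ blocks $\hat{B}_{ij} = \mathbb{E}[B \Phi_i \Phi_j]$ for $i,j = 1,\ldots,m$. The transformed system arises from the original linear dynamical system $\dot{x}(t,p) = A(p) x(t,p)$ by $y(t,p) := T(p) x(t,p)$. A real square matrix is called stable if all of its eigenvalues have strictly negative real part. A linear dynamical system $\dot{v} = Cv$ with constant matrix $C$ is asymptotically stable if and only if $C$ is stable. $L^{-1}$ denotes the pointwise matrix inverse $p \mapsto L(p)^{-1}$.
   Formalization: The stated integrability conditions do not ensure that the expected values E[BΦ_iΦ_j] exist; stability is proved whenever they do exist, and their existence is proved when the products Φ_iΦ_j (i,j ≤ m) lie in L². *)

(* Defs.v *)
From HB Require Import structures.
From mathcomp Require Import all_boot all_order all_algebra.
From mathcomp Require Import all_classical all_reals all_analysis.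
From mathcomp Require Import measurable_realfun.
From mathcomp Require Import complex.

Set Implicit Arguments.
Unset Strict Implicit.
Unset Printing Implicit Defensive.
Import Order.TTheory GRing.Theory Num.Theory.
Import numFieldNormedType.Exports.

Local Open Scope classical_set_scope.
Local Open Scope ring_scope.

(* Needed because the library does not export a sigma-finite instance for
   [\x]; it lets [lebesgue_tuple] iterate the product. *)
Lemma sigma_finite_product_measure1 d1 d2 (T1 : measurableType d1)
    (T2 : measurableType d2) (R : realType)
    (m1 : {sigma_finite_measure set T1 -> \bar R})
    (m2 : {sigma_finite_measure set T2 -> \bar R}) :
  sigma_finite [set: T1 * T2] (m1 \x m2)%E.
Proof.
have /sigma_finiteP[F [TF ndF Foo]] := sigma_finiteT m1.
have /sigma_finiteP[G [TG ndG Goo]] := sigma_finiteT m2.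
exists (fun i => F i `*` G i).
  rewrite -setXTT TF TG predeqE => -[x y]; split.
    move=> [/= [i _ Fix] [j _ Gjy]]; exists (maxn i j) => //; split.
    - by move: x Fix; exact/subsetPset/ndF/leq_maxl.
    - by move: y Gjy; exact/subsetPset/ndG/leq_maxr.
  by move=> [i _ []/= ? ?]; split; exists i.
move=> i; have [? ?] := Foo i; have [? ?] := Goo i.
split; first exact: measurableX.
by rewrite product_measure1E// lte_mul_pinfty// ge0_fin_numE.
Qed.

Section lebesgue_cons.
Context (R : realType) (k : nat).
Variable mu : {sigma_finite_measure set (k.-tuple R) -> \bar R}.

Let tcons (z : measurableTypeR R * k.-tuple R) : k.+1.-tuple R :=
  [tuple of (z.1 : R) :: z.2].

Let measurable_tcons : measurable_fun [set: _] tcons.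
Proof.
apply: measurable_cons; last exact: measurable_snd.
exact: (@measurable_fst _ _ (measurableTypeR R) (k.-tuple R)).
Qed.

Let prodmu := (@lebesgue_measure R \x mu)%E.

Definition lebesgue_cons : set (k.+1.-tuple R) -> \bar R :=
  pushforward prodmu tcons.

Let lebesgue_cons0 : lebesgue_cons set0 = 0%E.
Proof. exact: measure0. Qed.

Let lebesgue_cons_ge0 A : (0 <= lebesgue_cons A)%E.
Proof. exact: measure_ge0. Qed.

Let lebesgue_cons_sigma_additive : semi_sigma_additive lebesgue_cons.
Proof. exact: measure_semi_sigma_additive. Qed.

HB.instance Definition _ := isMeasure.Build _ _ _ lebesgue_cons
  lebesgue_cons0 lebesgue_cons_ge0 lebesgue_cons_sigma_additive.

Let lebesgue_cons_sigma_finite : sigma_finite [set: _] lebesgue_cons.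
Proof.
have [F TF mF] := sigma_finite_product_measure1 (@lebesgue_measure R) mu.
pose tuncons (t : k.+1.-tuple R) : measurableTypeR R * k.-tuple R :=
  (thead t, [tuple of behead t]).
have munc : measurable_fun setT tuncons.
  apply: (@measurable_fun_pair _ _ _ _ (measurableTypeR R) (k.-tuple R)).
    exact: measurable_tnth.
  exact: measurable_behead.
have unconsK : cancel tcons tuncons.
  move=> [x t]; rewrite /tuncons /tcons /= theadE; congr pair.
  exact: val_inj.
exists (fun i => tuncons @^-1` F i).
  by rewrite -preimage_bigcup -TF preimage_setT.
move=> i; have [mFi Fioo] := mF i; split.
  by rewrite -[X in measurable X]setTI; exact: munc.
rewrite /lebesgue_cons /pushforward -comp_preimage.
by rewrite (_ : tuncons \o tcons = id) //; apply/funext => z /=; rewrite unconsK.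
Qed.

HB.instance Definition _ := Measure_isSigmaFinite.Build _ _ _ lebesgue_cons
  lebesgue_cons_sigma_finite.

End lebesgue_cons.

(* Lebesgue measure on R^q = q.-tuple R, as an iterated product measure. *)
Fixpoint lebesgue_tuple (R : realType) (q : nat) :
    {sigma_finite_measure set (q.-tuple R) -> \bar R} :=
  match q with
  | 0 => \d_([tuple] : 0.-tuple R)
  | q'.+1 => lebesgue_cons (lebesgue_tuple R q')
  end.

Record pdf (R : realType) (q : nat) := Pdf {
  pdf_fun :> q.-tuple R -> R ;
  pdf_ge0 : forall p, 0 <= pdf_fun p ;
  measurable_pdf : measurable_fun [set: q.-tuple R] pdf_fun ;
  integral_pdf : (\int[lebesgue_tuple R q]_p (pdf_fun p)%:E = 1)%E }.

Section law.
Context (R : realType) (q : nat) (rho : pdf R q).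

(* The law rho(p) dp; it lives on R^q, the complement of Pi being null. *)
Definition pdf_prob (E : set (q.-tuple R)) : \bar R :=
  (\int[lebesgue_tuple R q]_(p in E) (rho p)%:E)%E.

Let pdf_prob0 : pdf_prob set0 = 0%E.
Proof. exact: integral_set0. Qed.

Let pdf_prob_ge0 E : (0 <= pdf_prob E)%E.
Proof. by apply: integral_ge0 => p _; rewrite lee_fin pdf_ge0. Qed.

Let pdf_prob_sigma_additive : semi_sigma_additive pdf_prob.
Proof.
move=> F mF tF mUF; rewrite /pdf_prob; apply: cvg_toP.
  apply: ereal_nondecreasing_is_cvgn => i j ij.
  apply: lee_sum_nneg_natr => // k _ _; apply: integral_ge0 => p _.
  by rewrite lee_fin pdf_ge0.
rewrite ge0_integral_bigcup//=.
- by apply/measurable_funTS/measurableT_comp => //; exact: measurable_pdf.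
- by move=> p _; rewrite lee_fin pdf_ge0.
Qed.

HB.instance Definition _ := isMeasure.Build _ _ _ pdf_prob
  pdf_prob0 pdf_prob_ge0 pdf_prob_sigma_additive.

Let pdf_prob_setT : pdf_prob [set: _] = 1%E.
Proof. exact: integral_pdf. Qed.

HB.instance Definition _ :=
  @Measure_isProbability.Build _ _ R pdf_prob pdf_prob_setT.

End law.

Section parameters.
Context (R : realType) (q : nat) (rho : pdf R q).

Definition row_of_tuple (p : q.-tuple R) : 'rV[R]_q := \row_i tnth p i.

(* Tuples carry the product sigma-algebra but no topology, hence the detour
   through row vectors for the closure. *)
Definition supp : set (q.-tuple R) :=
  row_of_tuple @^-1` closure (row_of_tuple @` [set p | rho p != 0]).

Definition independent_parameters : Prop :=
  forall E : 'I_q -> set R, (forall i, measurable (E i)) ->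
    pdf_prob rho [set p | forall i, E i (tnth p i)] =
    (\prod_(i < q) pdf_prob rho [set p | E i (tnth p i)])%E.

(* Functions on Pi = supp are represented by total functions on R^q whose
   values off Pi are irrelevant. *)
Definition ae_supp (P : q.-tuple R -> Prop) : Prop :=
  {ae pdf_prob rho, forall p, supp p -> P p}.

(* [r] may be [+oo]. *)
Definition in_Lr (r : \bar R) (f : q.-tuple R -> R) : Prop :=
  f \_ supp \in Lfun (pdf_prob rho) r.

(* [expect f] is the expected value only if [expectable f]; otherwise the
   library's integral is a junk value. *)
Definition expectable (f : q.-tuple R -> R) : Prop :=
  (pdf_prob rho).-integrable supp (EFin \o f).

Definition expect (f : q.-tuple R -> R) : R := \int[pdf_prob rho]_(p in supp) f p.

Definition inner (f g : q.-tuple R -> R) : R := expect (f \* g).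

(* Complete means maximal: only null functions are orthogonal to all [Phi i]. *)
Definition complete_orthonormal (Phi : nat -> q.-tuple R -> R) : Prop :=
  [/\ forall i, in_Lr 2%:E (Phi i),
      forall i j, inner (Phi i) (Phi j) = (i == j)%:R &
      forall f, in_Lr 2%:E f -> (forall i, inner f (Phi i) = 0) ->
        ae_supp (fun p => f p = 0)].

Section matrix_valued.
Context (n : nat).
Implicit Types B : q.-tuple R -> 'M[R]_n.

Definition measurable_mx B : Prop :=
  forall k l, measurable_fun supp (fun p => B p k l).

Definition mx_in_Lr (r : \bar R) B : Prop :=
  forall k l, in_Lr r (fun p => B p k l).

(* The first [m] basis functions are [Phi 0, ..., Phi m.-1]. *)
Definition galerkin_exists (m : nat) (Phi : nat -> q.-tuple R -> R) B : Prop :=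
  forall (i j : 'I_m) k l, expectable (fun p => B p k l * Phi i p * Phi j p).

Definition galerkin (m : nat) (Phi : nat -> q.-tuple R -> R) B :
    'M[R]_(\sum_(i < m) n, \sum_(j < m) n) :=
  \mxblock_(i < m, j < m)
    \matrix_(k < n, l < n) expect (fun p => B p k l * Phi i p * Phi j p).

End matrix_valued.
End parameters.

Section stability.
Context (R : realType).

Definition stable (N : nat) (C : 'M[R]_N) : Prop :=
  forall z : R[i], eigenvalue (map_mx (real_complex R) C) z -> complex.Re z < 0.

Definition solution (N : nat) (C : 'M[R]_N) (v : R -> 'cV[R]_N) : Prop :=
  forall (t : R) (k : 'I_N),
    is_derive t 1 (fun s => v s k 0) ((C *m v t) k 0).

(* Lyapunov stability and (global) attractivity of the equilibrium 0 of the
   system v' = C v, which is autonomous, so the initial time is 0. *)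
Definition asymptotically_stable (N : nat) (C : 'M[R]_N) : Prop :=
  (forall e : R, 0 < e -> exists2 d : R, 0 < d &
     forall v, solution C v -> `|v 0| < d -> forall t, 0 <= t -> `|v t| < e) /\
  (forall v, solution C v -> v t @[t --> +oo%R] --> (0 : 'cV[R]_N)).

Definition symmetric_mx (n : nat) (Q : 'M[R]_n) : Prop := Q^T = Q.

Definition positive_definite (n : nat) (Q : 'M[R]_n) : Prop :=
  forall x : 'cV[R]_n, x != 0 -> 0 < (x^T *m Q *m x) 0 0.

Definition lyapunov (n : nat) (A Q M : 'M[R]_n) : Prop :=
  A^T *m M + M *m A + Q = 0.

End stability.

(* Main.v *)
Require Import Defs.
From HB Require Import structures.
From mathcomp Require Import all_boot all_order all_algebra.
From mathcomp Require Import all_classical all_reals all_analysis.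
From mathcomp Require Import measurable_realfun.
From mathcomp Require Import complex ess_sup_inf.
From mathcomp Require Import ring lra.

Set Implicit Arguments.
Unset Strict Implicit.
Unset Printing Implicit Defensive.
Import Order.TTheory GRing.Theory Num.Theory.
Import numFieldNormedType.Exports.

Local Open Scope classical_set_scope.
Local Open Scope ring_scope.

(** Testing the Lyapunov equation on a left kernel vector of [L] shows that [L]
    is invertible; conjugating the equation by [L] then gives
    [B^T + B = - L^-1 Q L^-T], so [B p] has a negative definite quadratic form
    for almost all [p].  If [z] is a coefficient vector with blocks [z_i] and
    [w p = \sum_i Phi_i p z_i], then [z^T Bhat z = E (w^T B w)]; hence the
    Galerkin matrix inherits negative definiteness, with strictness coming from
    the orthonormality of the [Phi_i].  Such a matrix has its spectrum in the open
    left half-plane, and [|v|^2] decays exponentially along its trajectories. *)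

(** * Lyapunov equation *)

(* The equation gives [M (A - r) = - (A^T + r) M] with [A^T + r] invertible, so
   the factors of the polynomial can be cancelled one at a time. *)
Lemma sylvester_horner_eq0 (F : fieldType) (n : nat) (A M : 'M[F]_n.+1)
    (s : seq F) :
  (forall r, r \in s -> ~~ eigenvalue A (- r)) ->
  A^T *m M + M *m A = 0 ->
  M *m horner_mx A (\prod_(r <- s) ('X - r%:P)) = 0 -> M = 0.
Proof.
elim: s M => [|r s IH] M Hs eqM.
  by rewrite big_nil rmorph1 mulmx1.
rewrite big_cons rmorphM /= rmorphB /= horner_mx_X horner_mx_C mulmxA => M0.
have eqMr : M *m A = - (A^T *m M).
  by apply/eqP; rewrite -addr_eq0 addrC eqM.
have eqM' : M *m (A - r%:M) = - ((A^T + r%:M) *m M).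
  by rewrite mulmxBr eqMr mulmxDl opprD mul_mx_scalar mul_scalar_mx.
(* [M (A - r)] solves the same homogeneous equation, because [A^T] commutes with [A^T + r], so the
   induction hypothesis for the remaining factors applies. *)
have M'0 : M *m (A - r%:M) = 0.
  apply: IH M0 => [x xs|]; first by apply: Hs; rewrite in_cons xs orbT.
  rewrite eqM' mulmxN mulNmx -opprD; apply/eqP; rewrite oppr_eq0.
  have -> : A^T *m ((A^T + r%:M) *m M) = (A^T + r%:M) *m (A^T *m M).
    rewrite !mulmxA; congr (_ *m _).
    by rewrite mulmxDl mulmxDr scalar_mxC.
  by rewrite -mulmxA -mulmxDr eqM mulmx0.
(* Each nonzero row of [M^T] would be a left eigenvector of [A] for [- r]. *)
have MA0 : M^T *m (A + r%:M) = 0.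
  apply: trmx_inj; rewrite trmx_mul linearD /= trmxK tr_scalar_mx trmx0.
  by apply/eqP; rewrite -oppr_eq0 -eqM' M'0.
apply: trmx_inj; rewrite trmx0; apply/row_matrixP => i; rewrite row0.
apply/eqP; apply: contraT => v0.
have /negP[] := Hs r (mem_head _ _); apply/eigenvalueP.
exists (row i M^T) => //.
have /(congr1 (row i)) := MA0; rewrite row_mul row0 mulmxDr mul_mx_scalar.
by move/eqP; rewrite addr_eq0 -scaleNr => /eqP.
Qed.

(** Over the complex numbers the characteristic polynomial of [A] splits. Its roots have negative
    real part, so their opposites are not eigenvalues, and Cayley-Hamilton supplies the vanishing
    product. *)
Lemma lyapunov_kernel (R : realType) (n : nat) (A M : 'M[R]_n) :
  stable A -> A^T *m M + M *m A = 0 -> M = 0.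
Proof.
case: n A M => [|n] A M stA eqM; first by rewrite [M]thinmx0.
pose f := real_complex R.
suff /(congr1 (map_mx (@complex.Re R))) : map_mx f M = 0.
  by rewrite map_mx0 -map_mx_comp map_mx_id_in // => ->.
have [s Es] := closed_field_poly_normal (char_poly (map_mx f A)).
rewrite (monicP (char_poly_monic _)) scale1r in Es.
apply: (@sylvester_horner_eq0 _ _ (map_mx f A) _ s).
- move=> r rs; apply/negP => /stA /=; apply/negP; rewrite -leNgt.
  rewrite raddfN oppr_ge0 ltW //; apply: stA.
  by rewrite eigenvalue_root_char Es root_prod_XsubC.
- by rewrite map_trmx -!map_mxM -map_mxD eqM map_mx0.
- by rewrite -Es Cayley_Hamilton mulmx0.
Qed.

(** The Lyapunov operator is an endomorphism of a finite-dimensional space; being injective by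
    [lyapunov_kernel], it is bijective. *)
Lemma lyapunov_exists_unique (R : realType) (n : nat) (A Q : 'M[R]_n) :
  stable A -> exists! M : 'M[R]_n, lyapunov A Q M.
Proof.
move=> stA.
pose f : {linear 'M[R]_n -> 'M[R]_n} := (mulmx A^T \+ mulmxr A)%R.
have fE M : f M = A^T *m M + M *m A by [].
have fU : lin_mx f \in unitmx.
  rewrite -row_free_unit -kermx_eq0; apply/eqP/row_matrixP => i.
  rewrite row0; set u := row i _.
  have : u *m lin_mx f = 0 by rewrite /u -row_mul mulmx_ker row0.
  rewrite mul_rV_lin => /(congr1 vec_mx); rewrite mxvecK linear0 fE.
  by move=> /(lyapunov_kernel stA) /(congr1 mxvec); rewrite vec_mxK linear0.
pose M := vec_mx (mxvec (- Q) *m invmx (lin_mx f)).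
have fM : f M = - Q.
  by apply: (can_inj mxvecK); rewrite -mul_vec_lin /M vec_mxK mulmxKV.
exists M; split; first by rewrite /lyapunov -fE fM addNr.
move=> M'; rewrite /lyapunov -fE => /eqP; rewrite addr_eq0 -fM => /eqP fM'.
apply/eqP; rewrite -subr_eq0; apply/eqP/(lyapunov_kernel stA).
by rewrite -fE linearB fM' subrr.
Qed.

(** No symmetry is imposed: neither [B p] nor the Galerkin matrix is symmetric in general. *)
Definition negative_definite (R : realType) (n : nat) (C : 'M[R]_n) : Prop :=
  forall x : 'cV[R]_n, x != 0 -> (x^T *m C *m x) 0 0 < 0.

Lemma lyapunov_factor_unit (R : realType) (n : nat) (A Q M L : 'M[R]_n) :
  positive_definite Q -> lyapunov A Q M -> M = L *m L^T -> L \in unitmx.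
Proof.
move=> pQ; rewrite /lyapunov => eqM ML.
rewrite -row_free_unit -kermx_eq0; apply/eqP/row_matrixP => i.
rewrite row0; set y := row i _; apply/eqP; apply: contraT => y0.
have yL : y *m L = 0 by rewrite /y -row_mul mulmx_ker row0.
have := pQ y^T; rewrite trmx_eq0 trmxK => /(_ y0).
have /(congr1 (fun X => (y *m X *m y^T) 0 0)) := eqM.
rewrite mulmxDr mulmxDl mulmxDr mulmxDl ML !mulmxA yL !mul0mx addr0.
have Ly : L^T *m y^T = 0 by rewrite -trmx_mul yL trmx0.
by rewrite -(mulmxA _ L^T) Ly !mulmx0 add0r mul0mx !mxE => ->; rewrite ltxx.
Qed.

(** For [y = L^-T x], the form [x^T B x] equals [y^T M A y]. As [M] is symmetric, the Lyapunov
    equation says that twice this value is [- y^T Q y]. *)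
Lemma lyapunov_transform_negative (R : realType) (n : nat)
    (A Q M L : 'M[R]_n) :
  positive_definite Q -> lyapunov A Q M -> M = L *m L^T ->
  negative_definite (L^T *m A *m invmx L^T).
Proof.
move=> pQ eqM ML x x0; have Lu := lyapunov_factor_unit pQ eqM ML.
have LTu : L^T \in unitmx by rewrite unitmx_tr.
pose y := invmx L^T *m x.
have xE : x = L^T *m y by rewrite /y mulKVmx.
have y0 : y != 0 by apply: contra x0; rewrite xE => /eqP ->; rewrite mulmx0.
have -> : x^T *m (L^T *m A *m invmx L^T) *m x = y^T *m (M *m A) *m y.
  by rewrite ML -!mulmxA -/y {1}xE trmx_mul trmxK !mulmxA.
have := pQ _ y0; move: eqM; rewrite /lyapunov.
move=> /(congr1 (fun X => (y^T *m X *m y) 0 0)).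
rewrite !mulmxDr !mulmxDl mulmx0 mul0mx.
have -> : y^T *m (A^T *m M) *m y = (y^T *m (M *m A) *m y)^T.
  by rewrite ML !trmx_mul !trmxK !mulmxA.
by move: (_ *m (M *m A) *m _) (_ *m Q *m _) => X Y; rewrite !mxE; lra.
Qed.

(** * Spectrum of a negative definite matrix *)

Lemma map_mx_Re_real (R : realType) (m n p : nat) (v : 'M[R[i]]_(m, n))
    (C : 'M[R]_(n, p)) :
  map_mx (@complex.Re R) (v *m map_mx (real_complex R) C) =
  map_mx (@complex.Re R) v *m C.
Proof.
apply/matrixP => i j; rewrite !mxE raddf_sum; apply: eq_bigr => k _.
by rewrite !mxE; case: (v i k) => a b /=; rewrite mulr0 subr0.
Qed.

Lemma map_mx_Im_real (R : realType) (m n p : nat) (v : 'M[R[i]]_(m, n))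
    (C : 'M[R]_(n, p)) :
  map_mx (@complex.Im R) (v *m map_mx (real_complex R) C) =
  map_mx (@complex.Im R) v *m C.
Proof.
apply/matrixP => i j; rewrite !mxE raddf_sum; apply: eq_bigr => k _.
by rewrite !mxE; case: (v i k) => a b /=; rewrite mulr0 add0r.
Qed.

Lemma sqnormE (R : realType) (n : nat) (x : 'cV[R]_n) :
  (x^T *m x) 0 0 = \sum_k x k 0 ^+ 2.
Proof. by rewrite mxE; apply: eq_bigr => k _; rewrite mxE expr2. Qed.

Lemma sqnorm_ge0 (R : realType) (n : nat) (x : 'cV[R]_n) :
  0 <= (x^T *m x) 0 0.
Proof. by rewrite sqnormE sumr_ge0 // => k _; exact: sqr_ge0. Qed.

Lemma sqnorm_gt0 (R : realType) (n : nat) (x : 'cV[R]_n) :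
  x != 0 -> 0 < (x^T *m x) 0 0.
Proof.
move=> x0; rewrite lt_def sqnorm_ge0 andbT; apply: contra x0.
rewrite sqnormE psumr_eq0 => [/allP H|k _]; last exact: sqr_ge0.
apply/eqP/matrixP => k j; rewrite ord1 mxE.
by apply/eqP; rewrite -sqrf_eq0; exact: H (mem_index_enum k).
Qed.

(* For a left eigenvector [x + i y] with eigenvalue [a + i b], the quadratic
   form satisfies [x C x^T + y C y^T = a (|x|^2 + |y|^2)]. *)
Lemma negative_definite_stable (R : realType) (n : nat) (C : 'M[R]_n) :
  negative_definite C -> stable C.
Proof.
have sgn (u w a s t : R) : u + w = a * (s + t) -> u < 0 -> w <= 0 ->
    0 < s -> 0 <= t -> a < 0.
  by move=> + u0 w0 s0 t0; rewrite ltNge => uw; apply/negP => a0; nra.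
move=> nC z /eigenvalueP[v vC v0].
pose x : 'cV[R]_n := (map_mx (@complex.Re R) v)^T.
pose y : 'cV[R]_n := (map_mx (@complex.Im R) v)^T.
have xC : x^T *m C = complex.Re z *: x^T - complex.Im z *: y^T.
  rewrite !trmxK -map_mx_Re_real vC; apply/rowP => j; rewrite !mxE.
  by case: (z) (v 0 j) => [a b] [c d].
have yC : y^T *m C = complex.Re z *: y^T + complex.Im z *: x^T.
  rewrite !trmxK -map_mx_Im_real vC; apply/rowP => j; rewrite !mxE.
  by case: (z) (v 0 j) => [a b] [c d].
have xy : y^T *m x = x^T *m y.
  by apply/matrixP => i j; rewrite !mxE; apply: eq_bigr => k _;
    rewrite !mxE !ord1 mulrC.
have E : (x^T *m C *m x) 0 0 + (y^T *m C *m y) 0 0 =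
    complex.Re z * ((x^T *m x) 0 0 + (y^T *m y) 0 0).
  rewrite xC yC mulmxBl mulmxDl -!scalemxAl xy.
  by move: (x^T *m x) (y^T *m y) (x^T *m y) => X Y W; rewrite !mxE; ring.
have le0 (w : 'cV[R]_n) : (w^T *m C *m w) 0 0 <= 0.
  by have [->|w0] := eqVneq w 0; [rewrite mulmx0 mxE | exact: ltW (nC _ w0)].
(* As [v] is nonzero, so is [x] or [y]; whichever is nonzero supplies the two strict inequalities
   that [sgn] asks for. *)
have [x0|x0] := eqVneq x 0; last first.
  exact: sgn E (nC x x0) (le0 y) (sqnorm_gt0 x0) (sqnorm_ge0 y).
have y0 : y != 0.
  apply: contra v0 => /eqP y0; apply/eqP/rowP => j; rewrite mxE.
  have := congr1 (fun w : 'cV_n => w j 0) x0.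
  have := congr1 (fun w : 'cV_n => w j 0) y0.
  by rewrite !mxE; case: (v 0 j) => a b /= -> ->.
rewrite addrC (addrC ((x^T *m x) 0 0)) in E.
exact: sgn E (nC y y0) (le0 x) (sqnorm_gt0 y0) (sqnorm_ge0 x).
Qed.

(** * Exponential decay *)

(** Row vectors are used because the compactness argument in [negative_definite_coercive] takes
    place there. *)
Lemma continuous_quadratic_form (R : realType) (n : nat) (C : 'M[R]_n) :
  continuous (fun x : 'rV[R]_n => (x *m C *m x^T) 0 0).
Proof.
have -> : (fun x : 'rV[R]_n => (x *m C *m x^T) 0 0) =
    (fun x => \sum_j (\sum_i x 0 i * C i j) * x 0 j).
  by apply/funext => x; rewrite mxE; apply: eq_bigr => j _; rewrite !mxE.
have coord i : continuous (fun y : 'rV[R]_n => y 0 i).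
  exact: coord_continuous.
have lin j : continuous (fun y : 'rV[R]_n => \sum_i y 0 i * C i j).
  move=> x; apply: cvg_big => [||i _];
    [exact: add_continuous|exact: nbhs_filter|].
  exact: cvgM (coord i x) (cvg_cst _).
move=> x; apply: cvg_big => [||j _];
  [exact: add_continuous|exact: nbhs_filter|].
exact: cvgM (lin j x) (coord j x).
Qed.

Lemma norm_trmx (R : realType) (m n : nat) (x : 'M[R]_(m, n)) : `|x^T| = `|x|.
Proof.
rewrite /Num.norm /= !mx_normrE.
rewrite (reindex (fun ij : 'I_m * 'I_n => (ij.2, ij.1))) /=.
  by apply: eq_bigr => ij _; rewrite mxE.
by exists (fun ij => (ij.2, ij.1)) => -[].
Qed.

(** The matrix norm is the maximum norm. This bound and [sqnorm_le_mx_norm] relate it to the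
    Euclidean norm, in which the decay is proved. *)
Lemma mx_norm_sqr_le (R : realType) (n : nat) (x : 'cV[R]_n) :
  `|x| ^+ 2 <= (x^T *m x) 0 0.
Proof.
rewrite sqnormE; have [/eqP|/mx_norm_neq0[[i j] xE]] := eqVneq `|x| 0.
  by move=> /eqP ->; rewrite expr0n sumr_ge0 // => k _; exact: sqr_ge0.
have -> : `|x| = `|x i 0| by rewrite [LHS]xE /= ord1.
rewrite real_normK ?num_real // (bigD1 i) //= lerDl sumr_ge0 // => k _.
exact: sqr_ge0.
Qed.

Lemma sqnorm_le_mx_norm (R : realType) (n : nat) (x : 'cV[R]_n) :
  (x^T *m x) 0 0 <= n%:R * `|x| ^+ 2.
Proof.
rewrite sqnormE -[n in n%:R]card_ord mulr_natl -sumr_const ler_sum // => k _.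
rewrite -real_normK ?num_real // lerXn2r ?nnegrE //.
rewrite [leRHS]/Num.norm /= mx_normrE.
exact: (le_bigmax _ (fun ij => `|x ij.1 ij.2|) (k, 0)).
Qed.

(** On the compact unit sphere the form attains a maximum, which is negative and serves as [- c];
    homogeneity extends the bound to all vectors. *)
Lemma negative_definite_coercive (R : realType) (n : nat) (C : 'M[R]_n) :
  negative_definite C ->
  exists2 c, 0 < c &
    forall x : 'cV[R]_n, (x^T *m C *m x) 0 0 <= - c * (x^T *m x) 0 0.
Proof.
case: n C => [|n] C nC.
  by exists 1 => // x; rewrite [x]flatmx0 !mulmx0 mxE mulr0.
(* The Euclidean unit sphere, written with the identity matrix so that continuity of quadratic forms
   shows it closed. *)
pose S : set 'rV[R]_n.+1 := [set x | (x *m 1%:M *m x^T) 0 0 = 1].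
have S0 : S !=set0.
  exists (delta_mx 0 0); rewrite /S /= mulmx1 trmx_delta mul_delta_mx.
  by rewrite mxE !eqxx.
have cS : compact S.
  apply: bounded_closed_compact; last first.
    apply: (@closed_comp _ _ (fun x : 'rV[R]_n.+1 => (x *m 1%:M *m x^T) 0 0)
      [set 1]); last exact: closed_eq.
    by move=> x _; exact: continuous_quadratic_form.
  exists 1; split; first exact: num_real.
  move=> M M1 x; rewrite /S /= mulmx1 => xS; apply: le_trans (ltW M1).
  have := mx_norm_sqr_le x^T; rewrite trmxK xS.
  by rewrite norm_trmx expr_le1.
have [x0 Sx0 min0] := compact_EVT_max S0 cS
  (continuous_subspaceT (@continuous_quadratic_form _ _ C)).
have {}Sx0 : S x0 by rewrite inE in Sx0.
have x00 : x0^T != 0.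
  apply: contra_eqN Sx0 => /eqP/(congr1 trmx); rewrite trmxK trmx0 => ->.
  by rewrite mulmx1 mul0mx mxE eq_sym oner_eq0.
exists (- (x0 *m C *m x0^T) 0 0); first by rewrite oppr_gt0 -{1}[x0]trmxK nC.
move=> x; rewrite opprK.
have [->|xn0] := eqVneq x 0; first by rewrite !mulmx0 mxE mulr0.
have := sqnorm_gt0 xn0; set s := (x^T *m x) 0 0 => s0.
pose u := (Num.sqrt s)^-1 *: x^T.
have usq (D : 'M[R]_n.+1) : (u *m D *m u^T) 0 0 = s^-1 * (x^T *m D *m x) 0 0.
  rewrite /u linearZ /= trmxK -!scalemxAl -scalemxAr scalerA mxE.
  by rewrite -invfM -expr2 sqr_sqrtr // ltW.
have Su : S u by rewrite /S /= usq mulmx1 mulVf // gt_eqF.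
by have := min0 u; rewrite inE usq => /(_ Su); rewrite mulrC ler_pdivrMr.
Qed.

(** Gronwall's argument: [g = |v|^2] satisfies [g' = 2 v^T C v <= - 2 c g], so [h = expR (2 c s) g]
    is nonincreasing on the nonnegative half-line. *)
Lemma solution_sqnorm_decay (R : realType) (n : nat) (C : 'M[R]_n) (c : R)
    (v : R -> 'cV[R]_n) :
  (forall x : 'cV[R]_n, (x^T *m C *m x) 0 0 <= - c * (x^T *m x) 0 0) ->
  solution C v -> forall t, 0 <= t ->
  ((v t)^T *m v t) 0 0 <= expR (- (2 * c * t)) * ((v 0)^T *m v 0) 0 0.
Proof.
move=> cC solv t t0.
pose g (s : R) : R := ((v s)^T *m v s) 0 0.
have dg (s : R) : is_derive s 1 g (2 * ((v s)^T *m C *m v s) 0 0).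
  have -> : g = \sum_k (fun s => v s k 0) ^+ 2.
    by apply/funext => r; rewrite /g sqnormE fct_sumE.
  have -> : 2 * ((v s)^T *m C *m v s) 0 0 =
      \sum_k v s k 0 *+ 2 * (C *m v s) k 0.
    rewrite -mulmxA mxE mulr_sumr; apply: eq_bigr => k _.
    by rewrite mulr_natl -mulrnAl [(v s)^T _ _]mxE.
  apply: is_derive_sum => k; have := solv s k => dk.
  by apply: is_derive_eq; rewrite /= expr1 mulr_natl.
pose h (s : R) : R := expR (2 * c * s) * g s.
have dh (s : R) : is_derive s 1 h
    (expR (2 * c * s) * (2 * (c * g s + ((v s)^T *m C *m v s) 0 0))).
  have := dg s => dgs.
  have de : is_derive s 1 (fun s : R => expR (2 * c * s))
      (expR (2 * c * s) * (2 * c)).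
    have di : is_derive s 1 (fun s : R => 2 * c * s) (2 * c).
      have := is_deriveZ (2 * c) (is_derive_id s 1).
      by rewrite /GRing.scale /= mulr1.
    exact: is_derive1_comp (is_derive_expR (2 * c * s)) di.
  have := is_deriveM de dgs; rewrite /GRing.scale /= => dM.
  by apply: is_derive_eq; ring.
have hmono : h t <= h 0.
  apply: (@ler0_derive1_nincry _ h 0) => //.
  - move=> x _; have := dh x => dhx; rewrite derive1E derive_val.
    rewrite pmulr_rle0 ?expR_gt0 // pmulr_rle0 //.
    by have := cC (v x); rewrite -/(g x); lra.
  - apply: continuous_subspaceT => x; apply: differentiable_continuous.
    by apply/derivable1_diffP; exact: (@ex_derive _ _ _ _ _ _ _ (dh x)).
move: hmono; rewrite /h mulr0 expR0 mul1r => hmono.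
by rewrite expRN mulrC ler_pdivlMr ?expR_gt0 // mulrC.
Qed.

Lemma negative_definite_asymptotically_stable (R : realType) (n : nat)
    (C : 'M[R]_n) :
  negative_definite C -> asymptotically_stable C.
Proof.
move=> /negative_definite_coercive[c c0 cC].
have decay v : solution C v -> forall t, 0 <= t ->
    `|v t| ^+ 2 <= expR (- (2 * c * t)) * (n%:R * `|v 0| ^+ 2).
  move=> solv t t0; apply: le_trans (mx_norm_sqr_le _) _.
  apply: le_trans (solution_sqnorm_decay cC solv t0) _.
  by rewrite ler_wpM2l ?expR_ge0 // sqnorm_le_mx_norm.
split=> [e e0|v solv].
  have n1 : 0 < n%:R + 1 :> R by rewrite ltr_wpDl.
  (* This radius suffices because [n <= (n + 1)^2]; the added 1 keeps the denominator positive also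
     for [n = 0]. *)
  exists (e / (n%:R + 1)) => [|v solv v0 t t0]; first exact: divr_gt0.
  rewrite -(@ltr_pXn2r _ 2) ?nnegrE // ?ltW //.
  apply: le_lt_trans (decay v solv t t0) _.
  have ex1 : expR (- (2 * c * t)) <= 1.
    by rewrite expR_le1 oppr_le0 !mulr_ge0 // ltW.
  apply: (@le_lt_trans _ _ (n%:R * `|v 0| ^+ 2)).
    by rewrite ler_piMl // mulr_ge0 // sqr_ge0.
  have /ltW v0e : `|v 0| * (n%:R + 1) < e by rewrite -ltr_pdivlMr.
  have : (`|v 0| * (n%:R + 1)) ^+ 2 <= e ^+ 2.
    by rewrite lerXn2r ?nnegrE ?mulr_ge0 // ltW.
  have := normr_ge0 (v 0); have nn : 0 <= n%:R :> R by [].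
  have := sqr_ge0 `|v 0|.
  have : 0 < e ^+ 2 by rewrite exprn_gt0.
  move: nn; move: (n%:R : R) `|v 0| (e) => a b d. nra.
apply/cvgr0Pnorm_lt => e e0 /=.
have e20 : 0 < e ^+ 2 by rewrite exprn_gt0.
pose K := n%:R * `|v 0| ^+ 2.
have K0 : 0 <= K by rewrite mulr_ge0 // sqr_ge0.
near=> t.
have t0 : 0 <= t by [].
rewrite -(@ltr_pXn2r _ 2) ?nnegrE // ?ltW //.
apply: le_lt_trans (decay v solv t t0) _; rewrite -/K.
rewrite expRN mulrC ltr_pdivrMr ?expR_gt0 //.
(* Replacing the exponential by its lower bound [1 + 2 c t] yields an explicit threshold for [t]. *)
apply: (@lt_le_trans _ _ (e ^+ 2 * (1 + 2 * c * t))); last first.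
  by rewrite ler_pM2l // expR_ge1Dx.
rewrite mulrDr mulr1 mulrA -ltrBlDl -ltr_pdivrMl ?mulr_gt0 //.
by near: t; apply: nbhs_pinfty_gt; exact: num_real.
Unshelve. all: end_near. Qed.

(** * The support and Lebesgue spaces *)

(** Rational endpoints make the family of boxes countable, as measurability of the support
    requires. *)
Lemma nbhs_rV_box (R : realType) (q : nat) (x : 'rV[R]_q) (B : set 'rV[R]_q) :
  nbhs x B -> exists ab : {ffun 'I_q -> rat * rat},
    (forall i, x 0 i \in `]ratr (ab i).1, ratr (ab i).2[) /\
    (forall y : 'rV[R]_q, (forall i, y 0 i \in `]ratr (ab i).1, ratr (ab i).2[) ->
       B y).
Proof.
move=> [P /= nP PB].
have /choice[ab abP] : forall i : 'I_q, exists ab : rat * rat,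
    (x 0 i \in `]ratr ab.1, ratr ab.2[) /\
    forall y, y \in `]ratr ab.1, ratr ab.2[ -> P 0 i y.
  move=> i; have /nbhs_ballP[e /= e0 eP] := nP 0 i.
  have [a aI] : exists a : rat, ratr a \in `]x 0 i - e, x 0 i[.
    by apply: rat_in_itvoo; rewrite ltrBlDr ltrDl.
  have [b bI] : exists b : rat, ratr b \in `]x 0 i, x 0 i + e[.
    by apply: rat_in_itvoo; rewrite ltrDl.
  exists (a, b); move: aI bI; rewrite !in_itv /= => /andP[a1 a2] /andP[b1 b2].
  split=> [|y]; first by rewrite a2 b1.
  rewrite in_itv /= => /andP[y1 y2]; apply: eP; rewrite /ball /= ltr_distlC.
  by apply/andP; split; lra.
exists (finfun ab); split=> [i|y yI]; first by rewrite ffunE; case: (abP i).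
by apply: PB => i j; rewrite ord1; apply: (abP j).2; have := yI j; rewrite ffunE.
Qed.

(** The complement of the support is the countable union of the rational boxes on which [rho]
    vanishes identically. *)
Lemma measurable_supp (R : realType) (q : nat) (rho : pdf R q) :
  measurable (supp rho).
Proof.
pose box (ab : {ffun 'I_q -> rat * rat}) : set (q.-tuple R) :=
  [set p | forall i, (tnth p i \in `]ratr (ab i).1, ratr (ab i).2[)].
pose null ab := forall p, box ab p -> rho p = 0.
have -> : supp rho = ~` \bigcup_ab (if `[< null ab >] then box ab else set0).
  rewrite -[LHS]setCK; congr (~` _); apply/seteqP; split=> p /=.
    move=> /existsNP[B] /not_implyP[nB BE].
    have [ab [pab abB]] := nbhs_rV_box nB.
    exists ab => //; rewrite asboolT.
      by move=> i; have := pab i; rewrite mxE.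
    move=> r rab; apply: contrapT => r0; apply: BE.
    exists (row_of_tuple r); split.
      by exists r => //=; exact/eqP.
    by apply: abB => i; rewrite mxE.
  move=> [ab _]; case: asboolP => // nab pab cl.
  have : nbhs (row_of_tuple p)
      [set y : 'rV[R]_q | forall i, (y 0 i \in `]ratr (ab i).1, ratr (ab i).2[)].
    exists (fun _ i => `]ratr (ab i).1, ratr (ab i).2[%classic) => /=.
      by move=> i j; rewrite mxE; apply: near_in_itvoo; exact: pab.
    by move=> y yI i; exact: yI.
  move=> /cl[_ [[r /= /eqP r0 <-] rI]]; apply: r0; apply: nab => i.
  by have := rI i; rewrite mxE.
apply: measurableC; apply: countable_bigcupT_measurable.
  exact: countableP.
move=> ab; case: asboolP => // _.
have -> : box ab = \bigcap_i
    ((fun p : q.-tuple R => tnth p i) @^-1` `]ratr (ab i).1, ratr (ab i).2[%classic).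
  by apply/seteqP; split=> p /= H i; [move=> _|]; exact: H.
apply: fin_bigcap_measurable => [|i _]; first exact: finite_finset.
rewrite -[X in measurable X]setTI.
apply: (measurable_tnth i measurableT); exact: measurable_itv.
Qed.

Section lebesgue_bound.
Context d (T : measurableType d) (R : realType) (mu : probability T R).

(* A bound [C * F `^ (1 / r)] with [F] integrable treats all exponents
   uniformly, as [+oo^-1 = 0]. *)
Lemma Lfun_dominated (r : \bar R) (f : T -> R) :
  (1 <= r)%E -> f \in Lfun mu r ->
  exists C (F : T -> R), [/\ 0 <= C, forall x, 0 <= F x,
    mu.-integrable setT (EFin \o F) &
    {ae mu, forall x, `|f x| <= C * F x `^ fine r^-1}].
Proof.
case: r => [r| |] // r1 fr.
  rewrite lee_fin in r1; have r0 : r != 0 by rewrite gt_eqF // (lt_le_trans _ r1).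
  exists 1, (fun x => `|f x| `^ r); split => //.
  - exact: (Lfun_integrable r1 fr).
  - apply: nearW => x; rewrite mul1r inver (negbTE r0) /= -powRrM mulfV //.
    by rewrite powRr1.
have /ess_supr_bounded[M ae_M] : (ess_sup mu (EFin \o (Num.norm \o f)) < +oo)%E.
  have : finite_norm mu +oo f by apply: set_mem; exact: sub_Lfun_finLfun.
  by rewrite /finite_norm unlock /= [mu _]probability_setT lte01.
exists `|M|, (cst 0); split => //.
  exact: finite_measure_integrable_cst.
apply: filterS ae_M => x fM.
by rewrite invey powRr0 mulr1 (le_trans fM) // ler_norm.
Qed.

Lemma ae_le_integrable (f g : T -> R) :
  measurable_fun setT f -> {ae mu, forall x, `|f x| <= g x} ->
  (forall x, 0 <= g x) -> mu.-integrable setT (EFin \o g) ->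
  mu.-integrable setT (EFin \o f).
Proof.
move=> mf fg g0 /integrableP[mg goo]; apply/integrableP; split.
  exact/measurable_EFinP.
apply: le_lt_trans goo; apply: ae_ge0_le_integral => //.
- by do 2 apply: measurableT_comp => //.
- exact: measurableT_comp.
- by apply: filterS fg => x fgx _; rewrite /= lee_fin (ger0_norm (g0 x)).
Qed.

Lemma integrable_prod4 (q1 q2 q3 q4 : \bar R) (f1 f2 f3 f4 : T -> R) :
  (1 <= q1)%E -> (1 <= q2)%E -> (1 <= q3)%E -> (1 <= q4)%E ->
  fine q1^-1 + fine q2^-1 + fine q3^-1 + fine q4^-1 = 1 ->
  f1 \in Lfun mu q1 -> f2 \in Lfun mu q2 -> f3 \in Lfun mu q3 ->
  f4 \in Lfun mu q4 ->
  mu.-integrable setT (EFin \o (fun x => f1 x * f2 x * f3 x * f4 x)).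
Proof.
move=> h1 h2 h3 h4 sum1 Lf1 Lf2 Lf3 Lf4.
have mL r f : f \in Lfun mu r -> measurable_fun setT f.
  by move=> Lf; apply: set_mem; exact: (sub_Lfun_mfun Lf).
have e0 (r : \bar R) : (1 <= r)%E -> 0 <= fine r^-1.
  by move=> r1; rewrite fine_ge0 // inve_ge0 (le_trans _ r1).
have [C1 [F1 [C10 F10 iF1 b1]]] := Lfun_dominated h1 Lf1.
have [C2 [F2 [C20 F20 iF2 b2]]] := Lfun_dominated h2 Lf2.
have [C3 [F3 [C30 F30 iF3 b3]]] := Lfun_dominated h3 Lf3.
have [C4 [F4 [C40 F40 iF4 b4]]] := Lfun_dominated h4 Lf4.
(* The summand 1 makes [G] positive, so that powers of [G] multiply by adding exponents; it is
   integrable because [mu] is finite. *)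
pose G x := 1 + (F1 x + F2 x + F3 x + F4 x).
have G0 x : 0 < G x.
  by have := F10 x; have := F20 x; have := F30 x; have := F40 x; rewrite /G; lra.
apply: (@ae_le_integrable _ (fun x => C1 * C2 * C3 * C4 * G x)).
- exact: measurable_funM (measurable_funM (measurable_funM
    (mL _ _ Lf1) (mL _ _ Lf2)) (mL _ _ Lf3)) (mL _ _ Lf4).
- apply: filterS (filterI (filterI b1 b2) (filterI b3 b4)) => x.
  move=> [[{}b1 {}b2] [{}b3 {}b4]]; rewrite !normrM.
  have up C F r (y : R) : 0 <= C -> (1 <= r)%E -> 0 <= F <= G x ->
      y <= C * F `^ fine r^-1 -> y <= C * G x `^ fine r^-1.
    move=> C0 r1 /andP[F0 FG] /le_trans; apply; rewrite ler_wpM2l //.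
    by apply: ge0_ler_powR; rewrite ?nnegrE ?e0 // (le_trans F0).
  have := F10 x; have := F20 x; have := F30 x; have := F40 x => p4 p3 p2 p1.
  have FG1 : 0 <= F1 x <= G x by rewrite p1 /G /=; lra.
  have FG2 : 0 <= F2 x <= G x by rewrite p2 /G /=; lra.
  have FG3 : 0 <= F3 x <= G x by rewrite p3 /G /=; lra.
  have FG4 : 0 <= F4 x <= G x by rewrite p4 /G /=; lra.
  have {}b1 := up _ _ _ _ C10 h1 FG1 b1.
  have {}b2 := up _ _ _ _ C20 h2 FG2 b2.
  have {}b3 := up _ _ _ _ C30 h3 FG3 b3.
  have {}b4 := up _ _ _ _ C40 h4 FG4 b4.
  have -> : C1 * C2 * C3 * C4 * G x = (C1 * G x `^ fine q1^-1) *
      (C2 * G x `^ fine q2^-1) * (C3 * G x `^ fine q3^-1) *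
      (C4 * G x `^ fine q4^-1).
    rewrite -[in LHS](@powRr1 _ (G x)) ?ltW // -sum1.
    by rewrite !powRD ?(gt_eqF (G0 x)) ?implybT //; ring.
  by rewrite !ler_pM ?mulr_ge0.
- by move=> x; rewrite !mulr_ge0 // ltW.
- apply: (@integrableZl _ _ _ mu _ measurableT (C1 * C2 * C3 * C4) (EFin \o G)).
  have iD (f g : T -> R) : mu.-integrable setT (EFin \o f) ->
      mu.-integrable setT (EFin \o g) ->
      mu.-integrable setT (EFin \o (fun x => f x + g x)).
    exact: integrableD.
  apply: (iD); first exact: finite_measure_integrable_cst.
  exact: (iD _ _ (iD _ _ (iD _ _ iF1 iF2) iF3) iF4).
Qed.

End lebesgue_bound.

(** * Galerkin projection *)

Section galerkin_projection.
Context (R : realType) (q : nat) (rho : pdf R q).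

Let mu : probability (q.-tuple R) R := pdf_prob rho.

Lemma ae_suppS2 (P1 P2 P : q.-tuple R -> Prop) :
  (forall p, P1 p -> P2 p -> P p) ->
  ae_supp rho P1 -> ae_supp rho P2 -> ae_supp rho P.
Proof.
move=> PP; rewrite /ae_supp => ae1 ae2.
by apply: filterS (filterI ae1 ae2) => p [h1 h2] Sp; exact: PP (h1 Sp) (h2 Sp).
Qed.

Lemma ae_suppS (P1 P : q.-tuple R -> Prop) :
  (forall p, P1 p -> P p) -> ae_supp rho P1 -> ae_supp rho P.
Proof. by move=> PP ae1; exact: (ae_suppS2 (fun p h _ => PP p h) ae1 ae1). Qed.

(** Links [expectable], an integral over the support, with [in_Lr], which extends functions by
    zero. *)
Lemma expectable_restrict (f : q.-tuple R -> R) :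
  expectable rho f <-> mu.-integrable setT (EFin \o (f \_ (supp rho))).
Proof.
rewrite -restrict_EFin; exact: (integrable_mkcond _ (measurable_supp rho)).
Qed.

Lemma expectable_lincomb (I : finType) (c : I -> R) (f : I -> q.-tuple R -> R) :
  (forall i, expectable rho (f i)) ->
  expectable rho (fun p => \sum_i c i * f i p).
Proof.
move=> fI; rewrite /expectable.
have -> : EFin \o (fun p => \sum_i c i * f i p) =
    (fun p => \sum_i (c i)%:E * (f i p)%:E)%E.
  by apply/funext => p /=; rewrite sumEFin.
apply: integrable_sum; first exact: measurable_supp.
move=> i _; apply: integrableZl; [exact: measurable_supp|exact: fI].
Qed.

Lemma expect_lincomb (I : finType) (c : I -> R) (f : I -> q.-tuple R -> R) :
  (forall i, expectable rho (f i)) ->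
  expect rho (fun p => \sum_i c i * f i p) = \sum_i c i * expect rho (f i).
Proof.
move=> fI; have mS := measurable_supp rho.
have cfI i : mu.-integrable (supp rho) (fun p => (c i * f i p)%:E).
  exact: (integrableZl mS (c i) (fI i)).
rewrite /expect /Rintegral.
under eq_integral do rewrite -sumEFin.
rewrite integral_sum // -sum_fine => [|i _]; last exact: integrable_fin_num.
by apply: eq_bigr => i _; exact: (RintegralZl (c i) mS (fI i)).
Qed.

Lemma expect_ae0 (f : q.-tuple R -> R) :
  expectable rho f -> ae_supp rho (fun p => f p = 0) -> expect rho f = 0.
Proof.
move=> /integrableP[mf _] f0; have mS := measurable_supp rho.
rewrite /expect /Rintegral (ae_eq_integral (cst 0%E) _ mS) //.
  by rewrite integral0.
by apply: ae_suppS f0 => p /= ->.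
Qed.

(** The integral of [|h|] equals minus that of [h], hence is at most 0. This is how strictness
    survives taking expectations. *)
Lemma ae0_of_expect_ge0 (h : q.-tuple R -> R) :
  expectable rho h -> ae_supp rho (fun p => h p <= 0) -> 0 <= expect rho h ->
  ae_supp rho (fun p => h p = 0).
Proof.
move=> hI h_le0; rewrite /expect /Rintegral => h_ge0.
have mS := measurable_supp rho; have mh := (integrableP _ _ _ hI).1.
have hfin := integrable_fin_num mS hI.
have absE : (\int[mu]_(p in supp rho) `|(EFin \o h) p|)%E =
    (- \int[mu]_(p in supp rho) (EFin \o h) p)%E.
  rewrite -(integralN (integrable_add_def mS hI)); apply: ae_eq_integral => //.
  - exact: measurableT_comp.
  - exact: measurableT_comp.
  - by apply: ae_suppS h_le0 => p hp0 /=; rewrite ler0_norm.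
have /(ae_eq_integral_abs mu mS mh) h0 :
    (\int[mu]_(p in supp rho) `|(EFin \o h) p|)%E = 0%E.
  apply/eqP; rewrite eq_le integral_ge0 // andbT absE leeNl oppe0.
  by rewrite -(fineK hfin) lee_fin.
by apply: ae_suppS h0 => p [].
Qed.

(** Brings the pointwise form of [B p] and the form of the Galerkin matrix to the same single sum
    over a finite type, to which [expect_lincomb] applies. *)
Lemma mxblock_quadratic_form (n m : nat) (X : 'I_m -> 'I_m -> 'M[R]_n)
    (u : 'I_m -> 'cV[R]_n) :
  (\sum_j (\sum_i (u i)^T *m X i j) *m u j) 0 0 =
  \sum_(x : ('I_m * 'I_m) * ('I_n * 'I_n))
    u x.1.1 x.2.1 0 * u x.1.2 x.2.2 0 * X x.1.1 x.1.2 x.2.1 x.2.2.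
Proof.
rewrite summxE -(pair_bigA _ (fun ij kl =>
  u ij.1 kl.1 0 * u ij.2 kl.2 0 * X ij.1 ij.2 kl.1 kl.2)) /=.
rewrite -(pair_bigA _ (fun i j => \sum_(kl : 'I_n * 'I_n)
  u i kl.1 0 * u j kl.2 0 * X i j kl.1 kl.2)) /= exchange_big /=.
apply: eq_bigr => j _; rewrite mulmx_suml summxE; apply: eq_bigr => i _.
rewrite -(pair_bigA _ (fun k l => u i k 0 * u j l 0 * X i j k l)) /=.
rewrite exchange_big mxE; apply: eq_bigr => l _; rewrite mxE mulr_suml.
by apply: eq_bigr => k _; rewrite mxE mulrAC.
Qed.

Context (n m : nat) (Phi : nat -> q.-tuple R -> R).

Definition expansion (z : 'cV[R]_(\sum_(i < m) n)) (p : q.-tuple R) : 'cV[R]_n :=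
  \sum_(i < m) Phi i p *: submxcol z i.

Lemma expansion_quadratic_form (B : 'M[R]_n) z p :
  ((expansion z p)^T *m B *m expansion z p) 0 0 =
  \sum_(x : ('I_m * 'I_m) * ('I_n * 'I_n))
    submxcol z x.1.1 x.2.1 0 * submxcol z x.1.2 x.2.2 0 *
    (B x.2.1 x.2.2 * Phi x.1.1 p * Phi x.1.2 p).
Proof.
(* The scalars [Phi i p] and [Phi j p] move from the vectors into the matrix blocks. *)
transitivity ((\sum_(j < m) (\sum_(i < m) (submxcol z i)^T *m
    (\matrix_(k, l) (B k l * Phi i p * Phi j p))) *m submxcol z j) 0 0).
  congr (fun_of_matrix _ 0 0).
  rewrite {2}/expansion mulmx_sumr; apply: eq_bigr => j _.
  rewrite -scalemxAr scalemxAl; congr (_ *m _).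
  rewrite /expansion linear_sum /= mulmx_suml scaler_sumr; apply: eq_bigr => i _.
  rewrite linearZ /= -scalemxAl scalerA scalemxAr; congr (_ *m _).
  by apply/matrixP => k l; rewrite !mxE; ring.
by rewrite mxblock_quadratic_form; apply: eq_bigr => x _;
  congr (_ * _); rewrite mxE.
Qed.

Lemma galerkin_quadratic_form (B : q.-tuple R -> 'M[R]_n)
    (z : 'cV[R]_(\sum_(i < m) n)) :
  (z^T *m galerkin rho m Phi B *m z) 0 0 =
  \sum_(x : ('I_m * 'I_m) * ('I_n * 'I_n))
    submxcol z x.1.1 x.2.1 0 * submxcol z x.1.2 x.2.2 0 *
    expect rho (fun p => B p x.2.1 x.2.2 * Phi x.1.1 p * Phi x.1.2 p).
Proof.
rewrite -{1 2}(submxcolK z) tr_mxcol mul_mxrow_mxblock mul_mxrow_mxcol.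
by rewrite mxblock_quadratic_form; apply: eq_bigr => x _;
  congr (_ * _); rewrite mxE.
Qed.

Context (Phi_L2 : forall i, in_Lr rho 2%:E (Phi i)).
Context (Phi_orthonormal :
  forall i j, inner rho (Phi i) (Phi j) = (i == j)%:R).

Lemma expectable_basis_mul i j : expectable rho (Phi i \* Phi j).
Proof.
apply/expectable_restrict/Lfun1_integrable.
have -> : (Phi i \* Phi j) \_ (supp rho) =
    (Phi i \_ (supp rho)) \* (Phi j \_ (supp rho)).
  by apply/funext => p; rewrite /patch /=; case: ifP => // _; rewrite mulr0.
by apply: Lfun2_mul_Lfun1; exact: Phi_L2.
Qed.

(** By orthonormality, the expectation of component [k] of the expansion times [Phi j] is entry [k]
    of block [j] of [z]. *)
Lemma expansion_ae0 z : ae_supp rho (fun p => expansion z p = 0) -> z = 0.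
Proof.
move=> z0; rewrite -[z]submxcolK -[RHS]submxcolK; apply: eq_mxcol => j.
apply/colP => k; rewrite submxcol0 [RHS]mxE.
have Phi_sum p : (expansion z p) k 0 * Phi j p =
    \sum_i submxcol z i k 0 * (Phi i \* Phi j) p.
  rewrite summxE mulr_suml; apply: eq_bigr => i _.
  by rewrite [X in X * _]mxE /=; ring.
have E : expect rho (fun p => \sum_i submxcol z i k 0 * (Phi i \* Phi j) p) = 0.
  apply: expect_ae0.
    by apply: expectable_lincomb => i; exact: expectable_basis_mul.
  by apply: ae_suppS z0 => p ep; rewrite -Phi_sum ep mxE mul0r.
move: E; rewrite expect_lincomb => [|i]; last exact: expectable_basis_mul.
rewrite (bigD1 j) //= big1 => [|i ij].
  by rewrite -/(inner _ _ _) Phi_orthonormal eqxx mulr1 addr0.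
by rewrite -/(inner _ _ _) Phi_orthonormal (inj_eq val_inj) (negbTE ij) mulr0.
Qed.

(** If the form were nonnegative at [z], the nonpositive function [h] would vanish almost
    everywhere. Pointwise definiteness then makes the expansion vanish almost everywhere, so
    [z = 0]. *)
Lemma galerkin_negative_definite (B : q.-tuple R -> 'M[R]_n) :
  ae_supp rho (fun p => negative_definite (B p)) ->
  galerkin_exists rho m Phi B -> negative_definite (galerkin rho m Phi B).
Proof.
move=> nB exB z; rewrite ltNge; apply: contra => z0; apply/eqP/expansion_ae0.
pose h p := ((expansion z p)^T *m B p *m expansion z p) 0 0.
have hE : h = (fun p => \sum_(x : ('I_m * 'I_m) * ('I_n * 'I_n))
    submxcol z x.1.1 x.2.1 0 * submxcol z x.1.2 x.2.2 0 *
    (B p x.2.1 x.2.2 * Phi x.1.1 p * Phi x.1.2 p)).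
  by apply/funext => p; exact: expansion_quadratic_form.
have h0 : ae_supp rho (fun p => h p = 0).
  apply: ae0_of_expect_ge0.
  - by rewrite hE; apply: expectable_lincomb => x; exact: exB.
  - apply: ae_suppS nB => p nBp; rewrite /h.
    have [->|e0] := eqVneq (expansion z p) 0; first by rewrite mulmx0 mxE.
    exact: ltW (nBp _ e0).
  - rewrite hE expect_lincomb => [|x]; last exact: exB.
    by rewrite -galerkin_quadratic_form.
apply: ae_suppS2 nB h0 => p nBp hp0; apply/eqP; apply: contraT => e0.
by have := nBp _ e0; rewrite -/(h p) hp0 ltxx.
Qed.

End galerkin_projection.

(** * Existence of the Galerkin matrix and stability *)

(** Each integrand is a finite sum of products of entries of [L], [A], [L^-1] and the function
    [Phi i \* Phi j]. The reciprocal exponents sum to [1/2 + 1/2 = 1], so [integrable_prod4]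
    applies. *)
Lemma transformed_expectable (R : realType) (n m q : nat) (rho : pdf R q)
    (Phi : nat -> q.-tuple R -> R) (A L : q.-tuple R -> 'M[R]_n)
    (q1 q2 q3 : \bar R) :
  (1 <= q1)%E -> (1 <= q2)%E -> (1 <= q3)%E ->
  mx_in_Lr rho q1 A -> mx_in_Lr rho q2 L ->
  mx_in_Lr rho q3 (fun p => invmx (L p)) ->
  (2%:E^-1 = q1^-1 + q2^-1 + q3^-1)%E ->
  (forall i j : 'I_m, in_Lr rho 2%:E (Phi i \* Phi j)) ->
  galerkin_exists rho m Phi (fun p => (L p)^T *m A p *m invmx (L p)^T).
Proof.
move=> h1 h2 h3 LA LL LV sum2 LPhi i j k l.
have sum1 : fine q2^-1 + fine q1^-1 + fine q3^-1 + fine (2%:E : \bar R)^-1 = 1.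
  have fin (r : \bar R) : (1 <= r)%E -> r^-1%E \is a fin_num.
    case: r => [r| |] //; rewrite lee_fin inver => r1.
    by rewrite gt_eqF // (lt_le_trans _ r1).
  rewrite sum2 !fineD ?fin_numD ?fin //.
  have := congr1 fine sum2; rewrite !fineD ?fin_numD ?fin //.
  by rewrite inver pnatr_eq0 /=; lra.
(* The indices of [invmx (L p)] are swapped because the inverse of [L^T] is the transpose of
   [L^-1]. *)
pose f (x : 'I_n * 'I_n) p :=
  L p x.1 k * A p x.1 x.2 * invmx (L p) l x.2 * (Phi i \* Phi j) p.
have fI x : expectable rho (f x).
  apply/expectable_restrict.
  have -> : f x \_ (supp rho) = (fun p => ((fun p => L p x.1 k) \_ (supp rho)) p *
      ((fun p => A p x.1 x.2) \_ (supp rho)) p *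
      ((fun p => invmx (L p) l x.2) \_ (supp rho)) p *
      ((Phi i \* Phi j) \_ (supp rho)) p).
    by apply/funext => p; rewrite /patch; case: ifP => // _; rewrite !mulr0.
  apply: integrable_prod4 h2 h1 h3 _ sum1 (LL _ _) (LA _ _) (LV _ _) (LPhi _ _).
  by rewrite lee_fin ler1n.
have := expectable_lincomb (fun=> 1) fI; congr (expectable rho).
apply/funext => p; rewrite /f -mulrA mxE mulr_suml.
rewrite -(pair_bigA _ (fun a b =>
  1 * (L p a k * A p a b * invmx (L p) l b * (Phi i p * Phi j p)))) /=.
rewrite exchange_big; apply: eq_bigr => b _; rewrite mxE !mulr_suml.
by apply: eq_bigr => a _; rewrite -trmx_inv !mxE mul1r; ring.
Qed.

(** The exponent condition puts the entries of [B] in L^2, whereas [Phi i \* Phi j] is in general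
    only in L^1. Existence of the Galerkin matrix is therefore derived from square integrability of
    these products, and stability is asserted whenever that matrix exists. *)
Theorem theorem2 (R : realType) (n m q : nat)
    (n_gt0 : (0 < n)%N) (m_gt0 : (0 < m)%N) (q_gt0 : (0 < q)%N)
    (rho : pdf R q) (rho_indep : independent_parameters rho)
    (Phi : nat -> q.-tuple R -> R) (Phi_cons : complete_orthonormal rho Phi)
    (A Q : q.-tuple R -> 'M[R]_n)
    (A_meas : measurable_mx rho A) (Q_meas : measurable_mx rho Q)
    (A_stable : ae_supp rho (fun p => stable (A p)))
    (Q_spd : ae_supp rho (fun p => symmetric_mx (Q p) /\ positive_definite (Q p))) :
  ae_supp rho (fun p => exists! M : 'M[R]_n, lyapunov (A p) (Q p) M) /\
  forall M L : q.-tuple R -> 'M[R]_n,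
    ae_supp rho (fun p => lyapunov (A p) (Q p) (M p)) ->
    ae_supp rho (fun p => M p = L p *m (L p)^T) ->
  forall q1 q2 q3 : \bar R,
    (1 <= q1)%E -> (1 <= q2)%E -> (1 <= q3)%E ->
    mx_in_Lr rho q1 A ->
    mx_in_Lr rho q2 L ->
    mx_in_Lr rho q3 (fun p => invmx (L p)) ->
    (2%:E^-1 = q1^-1 + q2^-1 + q3^-1)%E ->
  let T p := (L p)^T in
  let B p := T p *m A p *m invmx (T p) in
  ((forall i j : 'I_m, in_Lr rho 2%:E (Phi i \* Phi j)) ->
     galerkin_exists rho m Phi B) /\
  (galerkin_exists rho m Phi B ->
     stable (galerkin rho m Phi B) /\
     asymptotically_stable (galerkin rho m Phi B)).
Proof.
split.
  by apply: ae_suppS A_stable => p; exact: lyapunov_exists_unique.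
move=> M L eqM ML q1 q2 q3 h1 h2 h3 LA LL LV sum2 T B.
case: Phi_cons => Phi_L2 Phi_on _.
split; first exact: (transformed_expectable h1 h2 h3 LA LL LV sum2).
have posQ : ae_supp rho (fun p =>
    positive_definite (Q p) /\ lyapunov (A p) (Q p) (M p)).
  by apply: ae_suppS2 Q_spd eqM => p [_ pQ].
have nB : ae_supp rho (fun p => negative_definite (B p)).
  apply: ae_suppS2 posQ ML => p [pQ eqMp] MLp.
  exact: lyapunov_transform_negative pQ eqMp MLp.
move=> /(galerkin_negative_definite Phi_L2 Phi_on nB) nG.
split; first exact: negative_definite_stable.
exact: negative_definite_asymptotically_stable.
Qed.
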